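(* $\sqcap'\mathrm{T^0_Q}\subsetneq\mathrm{PTR^0_Q}$.
   Context: A random-access Turing machine (RATM) is a Turing machine with $k\ge 2$ ordinary tapes (a read-only input tape, an output tape and work tapes), each equipped with its own write-only binary index tape; when it enters a special random-access state $q_a$, the heads of all ordinary tapes jump (in that step) to the cells whose addresses are written in binary on the respective index tapes. Running time is the number of steps. A Boolean query class $\mathcal Q$ is encoded as the language $S=\{\langle D,Q\rangle\}\subseteq\Sigma^*\times\Sigma^*$ with $\langle D,Q\rangle\in S$ iff $Q\in\mathcal Q$ is true on the dataset $D$. A language $S$ of pairs is pseudo-tractable by reducing datasets if there exist a polynomial-time computable preprocessing function $\Pi$ and a language $S'$ such that for all $D,Q$: $\langle D,Q\rangle\in S\iff\langle\Pi(D),Q\rangle\in S'$, $|\Pi(D)|<|D|$, and membership of $\langle\Pi(D),Q\rangle$ in $S'$ can be decided by a RATM in time $o(|D|)$. $\mathrm{PTR^0_Q}$ is the set of query classes whose languages are pseudo-tractable by reducing datasets. $\sqcap'\mathrm{T^0_Q}$ (Yang et al.) is the set of query classes $\mathcal Q$ of short queries ($|Q|\in O(\log|D|)$ for $\langle D,Q\rangle$) for which there exist a polynomial-time preprocessing function $\Pi$ with $|\Pi(D)|\in O(\log|D|)$ and a language $S'\in\mathrm{P}$ such that $\langle D,Q\rangle\in S\iff\langle\Pi(D),Q\rangle\in S'$ for all $D,Q$.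
   Formalization: The condition |Π(D)| < |D| is required only for all sufficiently long D (for empty D it cannot hold, so PTR⁰_Q would be empty and the inclusion false), and the alphabet Σ is assumed to have at least two letters. *)

(* Defs.v *)
From mathcomp Require Import all_boot.
From mathcomp Require Import classical_sets.

Set Implicit Arguments.
Unset Strict Implicit.
Unset Printing Implicit Defensive.

Local Open Scope classical_set_scope.

(* Tapes are one-way infinite with cells 0, 1, 2, ...; [None] is the blank and
   a tape is a sequence of symbols, blank beyond its end. *)

Inductive move := MoveLeft | Stay | MoveRight.

(* A head that moves left from cell 0 stays there. *)
Definition shift (m : move) (i : nat) : nat :=
  match m with MoveLeft => i.-1 | Stay => i | MoveRight => i.+1 end.

(* The nonblank string that starts in cell 0. *)
Fixpoint contents (T : Type) (s : seq (option T)) : seq T :=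
  if s is Some a :: s' then a :: contents s' else [::].

(* Most significant bit first; the empty string denotes 0. *)
Definition binary_value (s : seq bool) : nat :=
  foldl (fun n (b : bool) => n.*2 + b) 0 s.

(* The names of the #|W| + 2 ordinary tapes. *)
Inductive tape (W : Type) := Input | Output | Work of W.
Arguments Input {W}.
Arguments Output {W}.

(* The result of a transition.  Every ordinary tape has its own index tape,
   and the two are named alike.  Index tapes are write-only: the transition
   does not depend on their contents, and [None] as a value of [iwrite] leaves
   the scanned index cell as it is. *)
Record action (Q T Gamma : Type) := Action {
  next : Q;
  write : T -> Gamma;
  shead : T -> move;
  iwrite : T -> option (option bool);
  ihead : T -> move }.

(* Random-access Turing machines with input (and output) alphabet A.  The tape
   alphabet is A, the auxiliary symbols [aux] and the blank; [qa] is the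
   random-access state. *)
Record ratm (A : finType) := RATM {
  work : finType;
  aux : finType;
  state : finType;
  start : state;
  qa : state;
  halting : pred state;
  accepting : pred state;
  delta : state -> (tape work -> option (A + aux)) ->
          action state (tape work) (option (A + aux)) }.

Section Machine.
Variables (A : finType) (M : ratm A).

Record config := Config {
  cstate : state M;
  cells : tape (work M) -> seq (option (A + aux M));
  head : tape (work M) -> nat;
  icells : tape (work M) -> seq (option bool);
  ipos : tape (work M) -> nat }.

Definition init (w : seq A) : config :=
  Config (start M)
    (fun t => if t is Input then [seq Some (inl a) | a <- w] else [::])
    (fun=> 0) (fun=> [::]) (fun=> 0).

Definition scanned (c : config) : tape (work M) -> option (A + aux M) :=
  fun t => nth None (cells c t) (head c t).

(* The input tape is read-only: [write] has no effect on it.  A transition into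
   [qa] sends each ordinary head to the address on its index tape (as left by
   that same transition) instead of shifting it. *)
Definition step (c : config) : config :=
  if halting (cstate c) then c else
  let a := delta (cstate c) (scanned c) in
  let icells' t :=
    if iwrite a t is Some b then set_nth None (icells c t) (ipos c t) b
    else icells c t in
  Config (next a)
    (fun t => if t is Input then cells c t
              else set_nth None (cells c t) (head c t) (write a t))
    (fun t => if next a == qa M then binary_value (contents (icells' t))
              else shift (shead a t) (head c t))
    icells'
    (fun t => shift (ihead a t) (ipos c t)).

Definition run (w : seq A) (n : nat) : config := iter n step (init w).

Definition halts_within (w : seq A) (n : nat) : Prop :=
  halting (cstate (run w n)).

(* On input w, M decides within n steps whether P holds. *)
Definition decides_within (w : seq A) (P : Prop) (n : nat) : Prop :=
  halts_within w n /\ (accepting (cstate (run w n)) <-> P).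

Definition outputs_within (w v : seq A) (n : nat) : Prop :=
  halts_within w n /\ contents (cells (run w n) Output) = [seq inl a | a <- v].

(* An ordinary multitape Turing machine is a machine that never enters [qa]:
   its index tapes then have no influence on the computation. *)
Definition ordinary : Prop :=
  forall q r, next (delta (r := M) q r) <> qa M.

End Machine.

Definition big_O (f g : nat -> nat) : Prop :=
  exists c N, forall n, N <= n -> f n <= c * g n.

(* The usual definition with epsilon = 1/m. *)
Definition little_o (f g : nat -> nat) : Prop :=
  forall m, exists N, forall n, N <= n -> m * f n <= g n.

Definition log2 (n : nat) : nat := trunc_log 2 n.

(* The class P. *)
Definition in_P (A : finType) (L : set (seq A)) : Prop :=
  exists (M : ratm A) (c d : nat), ordinary M /\
    forall w, decides_within M w (L w) (c * size w ^ d + c).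

Definition polytime_computable (A : finType) (f : seq A -> seq A) : Prop :=
  exists (M : ratm A) (c d : nat), ordinary M /\
    forall w, outputs_within M w (f w) (c * size w ^ d + c).

Section QueryClasses.
Variable Sigma : finType.
Notation word := (seq Sigma).

(* A Boolean query class is identified with its language S of pairs:
   S (D, Q) means that Q is a query of the class and is true on D. *)
Definition query_class := set (word * word).

(* <x, y> is written on a tape as x#y, where the separator # is [None]. *)
Definition encode (p : word * word) : seq (option Sigma) :=
  [seq Some a | a <- p.1] ++ None :: [seq Some a | a <- p.2].

(* The inequality |Pi(D)| < |D| is required of all but finitely many D: it is
   unsatisfiable for empty D, and Pi would have to map all words of length 1
   to the empty word. *)
Definition PTR0Q : set query_class :=
  [set S | exists (Pi : word -> word) (S' : set (word * word)),
    [/\ polytime_computable Pi,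
        forall D Q, S (D, Q) <-> S' (Pi D, Q),
        exists N, forall D, N <= size D -> size (Pi D) < size D &
        exists (M : ratm (option Sigma)) (t : nat -> nat),
          little_o t id /\
          forall D Q, decides_within M (encode (Pi D, Q)) (S' (Pi D, Q))
                        (t (size D))]].

Definition short_queries (S : query_class) : Prop :=
  exists f, big_O f log2 /\ forall D Q, S (D, Q) -> size Q <= f (size D).

Definition PiT0Q : set query_class :=
  [set S | short_queries S /\
    exists (Pi : word -> word) (S' : set (word * word)),
    [/\ polytime_computable Pi,
        exists f, big_O f log2 /\ forall D, size (Pi D) <= f (size D),
        in_P (encode @` S') &
        forall D Q, S (D, Q) <-> S' (Pi D, Q)]].

End QueryClasses.

Arguments PTR0Q : clear implicits.
Arguments PiT0Q : clear implicits.

(* Main.v *)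
(** Inclusion.  Let [Pi] be a preprocessing function with logarithmic output and
    let [M0] decide [S'] in polynomial time.  A machine that sees only [Pi D]
    and [Q] cannot tell when [Q] is too long to be a query on [D], so its
    running time would not be bounded in [size D].  We therefore replace [Pi D] by
    [pad^k sep (Pi D)], where [k] is logarithmic in [size D] and bounds the
    length of every query on [D].  The length of the pad is obtained by halving
    [size D] repeatedly, with two counters.  The decider compares [Q] with the
    pad while copying [Pi D # Q] to a work tape, rejects [Q] as soon as it is
    longer than the pad, and otherwise runs [M0] on the copy; this takes time
    polynomial in the logarithm of [size D].

    Strictness.  The class of all pairs does not have short queries, but it is
    decided in no time after erasing the dataset. *)
From Pilot Require Import Defs.
From mathcomp Require Import all_boot.
From mathcomp Require Import classical_sets.
From HB Require Import structures.
From mathcomp Require Import boolp zify.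
Import Pilot.Defs.
Local Open Scope classical_set_scope.

Set Implicit Arguments.
Unset Strict Implicit.
Unset Printing Implicit Defensive.

(** * Growth of polynomials in the logarithm *)

(** Passing from [l] to [l./2] replaces [l.+1] by at most [2 * l./2.+1]. Of the two factors
    [2 ^ l./2] available below [2 ^ l], one absorbs a single [l./2.+1]; the induction hypothesis for
    the constant [C * 2 ^ d.+1] uses the other. *)
Lemma poly_le_exp2 d C :
  exists L, forall l, L <= l -> C * l.+1 ^ d <= 2 ^ l.
Proof.
elim: d C => [|d IHd] C.
  by exists C => l leCl; rewrite muln1 (leq_trans leCl) // ltnW // ltn_expl.
have [L leL] := IHd (C * 2 ^ d.+1); exists L.*2 => l le_Ll.
have /leL leh : L <= l./2 by rewrite -(doubleK L) half_leq.
have le_l : l.+1 <= 2 * l./2.+1 by lia.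
have lt_h : l./2.+1 <= 2 ^ l./2 by rewrite ltn_expl.
apply: (@leq_trans (C * (2 * l./2.+1) ^ d.+1)).
  by rewrite leq_mul2l leq_exp2r // le_l orbT.
rewrite expnMn mulnA (expnSr l./2.+1) mulnA.
apply: (leq_trans (leq_mul leh lt_h)); rewrite -expnD leq_exp2l //.
by rewrite addnn -{2}(odd_double_half l) leq_addl.
Qed.

Lemma polylog_little_o C d : little_o (fun n => C * (log2 n).+1 ^ d) id.
Proof.
move=> m; have [L leL] := poly_le_exp2 d (m * C).
exists (2 ^ L) => n le_n.
have n_gt0 : 0 < n by rewrite (leq_trans _ le_n) ?expn_gt0.
rewrite mulnA (leq_trans (leL _ _)) ?trunc_logP //.
exact: trunc_log_max.
Qed.

(** The finitely many exceptions are absorbed by their maximum; the successor keeps the bound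
    effective where [log2] vanishes. *)
Lemma big_O_log2 f : big_O f log2 -> exists a, forall n, f n <= a * (log2 n).+1.
Proof.
case=> c [N leN]; exists (c + \max_(i < N) f i) => n.
have [/leN le_n|lt_nN] := leqP N n.
  by apply: (leq_trans le_n); rewrite leq_mul ?leq_addr.
apply: (@leq_trans (\max_(i < N) f i)); last by rewrite mulnS mulnDl; lia.
exact: (leq_bigmax (Ordinal lt_nN)).
Qed.

Lemma log2_le n : log2 n <= n.
Proof.
case: n => // n; apply: leq_trans (trunc_logP (_ : 1 < 2) (ltn0Sn n)) => //.
exact: ltnW (ltn_expl _ _).
Qed.

(** The number of terms of [n], [n./2], ... down to and including 0; one block of the pad is written
    per term. *)
Definition rounds n := if n is 0 then 1 else (log2 n).+2.

Lemma rounds_half n : 0 < n -> rounds n = (rounds n./2).+1.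
Proof.
by case: n => [|[|n]] // _; rewrite /rounds /log2 trunc_log2S //; case: n.
Qed.

Lemma log2_lt_rounds n : log2 n < rounds n.
Proof. by case: n. Qed.

Lemma rounds_le n : rounds n <= 2 * (log2 n).+1.
Proof. by case: n => [|n] //=; lia. Qed.

(** * Machines whose tapes are functions *)

Section Tapes.
Variable G : Type.

(** As a function, a tape does not record trailing blanks, so writing back the scanned symbol
    changes nothing ([update_id]) and configurations can be compared by equality. *)
Definition tape_of (v : seq G) (i : nat) : option G := nth None (map Some v) i.

Definition update (f : nat -> option G) i x : nat -> option G :=
  fun j => if j == i then x else f j.

Lemma update_id f i : update f i (f i) = f.
Proof. by apply: funext => j; rewrite /update; case: eqP => [->|]. Qed.

Lemma tape_of_nil : tape_of [::] = fun=> None.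
Proof. by apply: funext => i; rewrite /tape_of nth_nil. Qed.

Lemma tape_of_rcons v x :
  update (tape_of v) (size v) (Some x) = tape_of (rcons v x).
Proof.
apply: funext => i; rewrite /update /tape_of map_rcons nth_rcons size_map.
by case: ltngtP => // lt_v; rewrite nth_default ?size_map // ltnW.
Qed.

Lemma tape_of_default v i : size v <= i -> tape_of v i = None.
Proof. by move=> le_v; rewrite /tape_of nth_default ?size_map. Qed.

Lemma tape_of_cat u v i : tape_of (u ++ v) (size u + i) = tape_of v i.
Proof.
by rewrite /tape_of map_cat nth_cat size_map ltnNge leq_addr /= addKn.
Qed.

Lemma tape_of_size_cat u x v : tape_of (u ++ x :: v) (size u) = Some x.
Proof. by rewrite -[X in tape_of _ X]addn0 tape_of_cat. Qed.

Lemma tape_of_nth x0 v i : i < size v -> tape_of v i = Some (nth x0 v i).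
Proof. by move=> lt_i; rewrite /tape_of (nth_map x0). Qed.

Lemma nth_contents (s : seq (option G)) i :
  i <= size (contents s) -> nth None s i = tape_of (contents s) i.
Proof. by elim: s i => [|[a|] s IHs] [|i] //=; rewrite ?ltnS => /IHs. Qed.

Lemma contents_tape_of s v : nth None s = tape_of v -> contents s = v.
Proof.
elim: s v => [|x s IHs] [|a v] // E; have := congr1 (@^~ 0) E => //=.
  by rewrite /= => ->.
rewrite /= => ->; congr (_ :: _).
by apply: IHs; apply: funext => i; have := congr1 (@^~ i.+1) E.
Qed.

End Tapes.

Lemma tape_of_map_cat T G (f : T -> G) u x v :
  tape_of (map f (u ++ x :: v)) (size u) = Some (f x).
Proof. by rewrite map_cat -(size_map f) tape_of_size_cat. Qed.

(** * Timed runs without index tapes *)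

Section Simulation.
Variables (A : finType) (M : ratm A).

Record fconfig := FConfig {
  fstate : state M;
  ftape : tape (work M) -> nat -> option (A + aux M);
  fhead : tape (work M) -> nat }.

(* Faithful as long as the index tapes are blank whenever [qa] is entered: then
   the heads jump to cell 0. *)
Definition fstep (c : fconfig) : fconfig :=
  if halting (fstate c) then c else
  let a := delta (fstate c) (fun t => ftape c t (fhead c t)) in
  FConfig (next a)
    (fun t => if t is Input then ftape c t
              else update (ftape c t) (fhead c t) (write a t))
    (fun t => if next a == qa M then 0 else shift (shead a t) (fhead c t)).

Lemma fstep_shift c (a := delta (fstate c) (fun t => ftape c t (fhead c t))) :
  halting (fstate c) = false -> next a <> qa M ->
  fstep c = FConfig (next a)
    (fun t => if t is Input then ftape c t
              else update (ftape c t) (fhead c t) (write a t))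
    (fun t => shift (shead a t) (fhead c t)).
Proof. by move=> hF /eqP/negPf neq_qa; rewrite /fstep hF neq_qa. Qed.

Definition finit (w : seq A) : fconfig :=
  FConfig (start M)
    (fun t => if t is Input then tape_of (map inl w) else fun=> None)
    (fun=> 0).

Definition forget (c : config M) : fconfig :=
  FConfig (cstate c) (fun t => nth None (cells c t)) (head c).

Definition index_free : Prop :=
  forall q r t, iwrite (delta (r := M) q r) t = None.

Lemma icells_run w n : index_free -> icells (run M w n) = fun=> [::].
Proof.
move=> ifree; rewrite /run; elim: n => [|n IHn] //=; rewrite /step.
by case: ifP => // _ /=; rewrite IHn; apply: funext => t; rewrite ifree.
Qed.

(** An ordinary machine never jumps. An index-free one keeps its index tapes empty, so a jump leads
    to the address denoted by the empty string, which is 0 as in [fstep]. *)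
Lemma forget_run w n :
  ordinary M \/ index_free -> forget (run M w n) = iter n fstep (finit w).
Proof.
move=> hM; rewrite /run; elim: n => [|n IHn].
  rewrite /forget /finit; congr FConfig; apply: funext => -[||x] //=;
    apply: funext => i; rewrite ?nth_nil //.
  by rewrite /tape_of -map_comp.
rewrite !iterS -IHn; have := @icells_run w n; rewrite /run.
move: (iter n _ _) => c ic; rewrite /forget /step /fstep /=.
case: ifP => // _; rewrite /scanned /=.
congr FConfig; apply: funext => t /=.
  by case: t => [||x] //; apply: funext => i; rewrite nth_set_nth.
case: eqP => // eq_qa; case: hM => [/(_ _ _ eq_qa) // | ifree].
by rewrite ifree ic.
Qed.

(** An upper bound on the number of steps is enough, since halting configurations are fixed by
    [fstep]: [reaches_halting] recovers the state after exactly [n] steps. *)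
Definition reaches n c c' : Prop := exists2 m, m <= n & iter m fstep c = c'.

Lemma reaches_refl c : reaches 0 c c.
Proof. by exists 0. Qed.

Lemma reaches_step c c' : fstep c = c' -> reaches 1 c c'.
Proof. by exists 1. Qed.

Lemma reaches_trans n1 n2 c1 c2 c3 :
  reaches n1 c1 c2 -> reaches n2 c2 c3 -> reaches (n1 + n2) c1 c3.
Proof.
move=> [m1 le1 <-] [m2 le2 <-]; exists (m1 + m2); first exact: leq_add.
by rewrite addnC iterD.
Qed.

Lemma reaches_leq n1 n2 c c' : n1 <= n2 -> reaches n1 c c' -> reaches n2 c c'.
Proof. by move=> le12 [m le_m <-]; exists m => //; exact: leq_trans le12. Qed.

Lemma reaches_stepr n c1 c2 c3 :
  fstep c1 = c2 -> reaches n c2 c3 -> reaches n.+1 c1 c3.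
Proof. by move=> /reaches_step; apply: reaches_trans. Qed.

Lemma reaches_halting n c c' :
  reaches n c c' -> halting (fstate c') -> iter n fstep c = c'.
Proof.
move=> [m le_m <-] h; rewrite -(subnK le_m) iterD.
by elim: (n - m) => //= k ->; rewrite /fstep h.
Qed.

(** Without jumps a head moves at most one cell per step. This bounds the time for rewinding the
    simulated output tape. *)
Lemma fhead_iter n w t : ordinary M -> fhead (iter n fstep (finit w)) t <= n.
Proof.
move=> ordM; elim: n => //= n IHn; rewrite {1}/fstep.
case: ifP => _; first exact: leqW.
rewrite /= ifN; last exact/eqP/ordM.
by case: shead => /=; lia.
Qed.

End Simulation.
(** * A preprocessing function with a logarithmic pad *)

(** [PScan] measures the input, [PEmit b] writes a block of [K.+1] pads, and [PPass b] halves
    counter [b] into the other counter. [PSim] runs [M], and [PCopy] appends its output after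
    [PRewind]. [PNever] is the random-access state, which is never entered. *)
Inductive pstate (Q : Type) (K : nat) :=
| PStart | PScan | PEmit of bool & 'I_K.+1 | PPass of bool & bool | PSep
| PSim of Q | PRewind | PCopy | PHalt | PNever.
Arguments PStart {Q K}.
Arguments PScan {Q K}.
Arguments PEmit {Q K}.
Arguments PPass {Q K}.
Arguments PSep {Q K}.
Arguments PSim {Q K}.
Arguments PRewind {Q K}.
Arguments PCopy {Q K}.
Arguments PHalt {Q K}.
Arguments PNever {Q K}.

Definition pstate_code Q K (q : pstate Q K) :
    Q + (bool * 'I_K.+1 + bool * bool) + 'I_7 :=
  match q with
  | PSim q => inl (inl q)
  | PEmit b i => inl (inr (inl (b, i)))
  | PPass b p => inl (inr (inr (b, p)))
  | PStart => inr (inord 0) | PScan => inr (inord 1) | PSep => inr (inord 2)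
  | PRewind => inr (inord 3) | PCopy => inr (inord 4) | PHalt => inr (inord 5)
  | PNever => inr (inord 6)
  end.

(** The code 6 of [PNever] lies beyond the list and is decoded by the default value of [nth]. *)
Definition pstate_decode Q K (x : Q + (bool * 'I_K.+1 + bool * bool) + 'I_7) :
    pstate Q K :=
  match x with
  | inl (inl q) => PSim q
  | inl (inr (inl (b, i))) => PEmit b i
  | inl (inr (inr (b, p))) => PPass b p
  | inr i => nth PNever [:: PStart; PScan; PSep; PRewind; PCopy; PHalt] i
  end.

Lemma pstate_codeK Q K : cancel (@pstate_code Q K) (@pstate_decode Q K).
Proof. by case=> //=; rewrite inordK. Qed.

HB.instance Definition _ (Q : finType) K :=
  Finite.copy (pstate Q K) (can_type (@pstate_codeK Q K)).

Section PaddingMachine.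
Variables (A : finType) (M : ratm A) (K : nat) (pad sep : A).

(* [inr (inl b)] are two counters: their tapes are blank except for a mark in
   cell 0, and the values are the head positions.  [inr (inr true)] is a third
   one, which follows the head of the output tape [inr (inr false)] of [M]. *)
Definition pwork : finType := (work M + (bool + bool))%type.

Notation ptape := (tape pwork).
Notation psym := (option (A + aux M)).
Notation pst := (pstate (state M) K).

Definition counter (b : bool) : ptape := Work (inr (inl b)).
Definition tracker : ptape := Work (inr (inr true)).
Definition msym : psym := Some (inl pad).

Definition simulated (t : tape (work M)) : ptape :=
  match t with
  | Input => Input
  | Output => Work (inr (inr false))
  | Work w => Work (inl w)
  end.

Definition pact (q : pst) (wr : ptape -> psym) (mv : ptape -> move) :=
  Action q wr mv (fun=> None) (fun=> Stay).

(** The input head steps left throughout [PPass]: the first pass takes as many steps as the input is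
    long and brings it back to cell 0, where later passes leave it, ready for [M]. *)
Definition pdelta (q : pst) (r : ptape -> psym) : action pst ptape psym :=
  match q with
  | PStart =>
    pact PScan (fun t => match t with
                         | Work (inr (inl _)) | Work (inr (inr true)) => msym
                         | _ => r t end) (fun=> Stay)
  | PScan =>
    if r Input is Some _ then
      pact PScan r (fun t => match t with
                             | Input | Work (inr (inl true)) => MoveRight
                             | _ => Stay end)
    else pact (PEmit true ord_max) r (fun=> Stay)
  | PEmit b i =>
    pact (if i == 0 :> nat then if r (counter b) is None then PPass b false
                                else PSep
          else PEmit b (inord i.-1))
      (fun t => if t is Output then Some (inl pad) else r t)
      (fun t => if t is Output then MoveRight else Stay)
  | PPass b p =>
    if r (counter b) is None then
      pact (PPass b (~~ p)) r
        (fun t => match t with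
                  | Input => MoveLeft
                  | Work (inr (inl b')) => if b' == b then MoveLeft
                                           else if p then MoveRight else Stay
                  | _ => Stay end)
    else pact (PEmit (~~ b) ord_max) r (fun=> Stay)
  | PSep =>
    pact (PSim (start M))
      (fun t => if t is Output then Some (inl sep) else r t)
      (fun t => if t is Output then MoveRight else Stay)
  | PSim q =>
    if halting q then pact PRewind r (fun=> Stay) else
    let a := delta q (fun t => r (simulated t)) in
    pact (PSim (next a))
      (fun t => match t with
                | Work (inl w) => write a (Work w)
                | Work (inr (inr false)) => write a Output
                | _ => r t end)
      (fun t => match t with
                | Input => shead a Input
                | Work (inl w) => shead a (Work w)
                | Work (inr (inr _)) => shead a Output
                | _ => Stay end)
  | PRewind =>
    if r tracker is None then
      pact PRewind r (fun t => if t is Work (inr (inr _)) then MoveLeft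
                               else Stay)
    else pact PCopy r (fun=> Stay)
  | PCopy =>
    if r (simulated Output) is Some x then
      pact PCopy (fun t => if t is Output then Some x else r t)
        (fun t => match t with
                  | Output | Work (inr (inr _)) => MoveRight
                  | _ => Stay end)
    else pact PHalt r (fun=> Stay)
  | PHalt | PNever => pact PHalt r (fun=> Stay)
  end.

Definition padding_machine : ratm A :=
  @RATM A pwork (aux M) pst PStart PNever
    (fun q => if q is PHalt then true else false) xpred0 pdelta.

Lemma padding_machine_ordinary : ordinary padding_machine.
Proof.
move=> q r /=; case: q => [||b i|b p||q||||] //=.
- by case: (r Input).
- by case: eqP => //; case: (r _).
- by case: (r _).
- by case: halting.
- by case: (r _).
- by case: (r _).
Qed.

Let pstep c hF := @fstep_shift _ _ c hF (@padding_machine_ordinary _ _).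

Notation mark := (tape_of [:: (inl pad : A + aux M)]).

Lemma mark_pos h : 0 < h -> mark h = None.
Proof. by move=> h_gt0; rewrite tape_of_default. Qed.

Variable D : seq A.

(** Here [s] is the value of counter [b], the one being emptied, and [d] that of the other one,
    being filled. *)
Definition pad_conf (q : pst) i b s d (out : seq A) : fconfig padding_machine :=
  @FConfig _ padding_machine q
    (fun t => match t with
              | Input => tape_of (map inl D)
              | Output => tape_of (map inl out)
              | Work (inr (inl _)) | Work (inr (inr true)) => mark
              | _ => fun=> None end)
    (fun t => match t with
              | Input => i
              | Output => size out
              | Work (inr (inl b')) => if b' == b then s else d
              | _ => 0 end).

Lemma pad_conf_swap q i b s d out :
  pad_conf q i b s d out = pad_conf q i (~~ b) d s out.
Proof.
congr FConfig; apply: funext => -[||[w|[b'|]]] //.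
by case: b' b => [] [].
Qed.

Lemma scan_start :
  reaches 1 (finit padding_machine D) (pad_conf PScan 0 true 0 0 [::]).
Proof.
apply: reaches_step; rewrite pstep //.
congr FConfig; apply: funext => -[||[w|[b|[]]]] //=;
  rewrite ?tape_of_nil; try by rewrite [LHS]update_id.
- by apply: funext => -[|[]].
- by apply: funext => -[|[]].
- by case: ifP.
Qed.

Lemma scan_input j : j <= size D ->
  reaches j.+1 (pad_conf PScan (size D - j) true (size D - j) 0 [::])
    (pad_conf (PEmit true ord_max) (size D) true (size D) 0 [::]).
Proof.
elim: j => [|j IHj] le_j.
  apply: reaches_step; rewrite subn0 pstep //= tape_of_default ?size_map //=.
  congr FConfig; apply: funext => -[||[w|[b|[]]]] //=; exact: update_id.
apply: reaches_stepr (IHj _); last exact: ltnW.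
have lt_j : size D - j.+1 < size (map (@inl A (aux M)) D).
  by rewrite size_map; lia.
rewrite pstep //=.
case E: (tape_of _ _) => [x|]; last first.
  by case: D lt_j E => // a D' lt_j; rewrite (tape_of_nth (inl a)).
have eq_j : (size D - j.+1).+1 = size D - j by lia.
by congr FConfig; apply: funext => -[||[w|[[]|[]]]] //=; exact: update_id.
Qed.

Lemma emit_round i b s d (n : 'I_K.+1) out :
  reaches n.+1 (pad_conf (PEmit b n) i b s d out)
    (pad_conf (if s == 0 then PSep else PPass b false) i b s d
       (out ++ nseq n.+1 pad)).
Proof.
have step_emit (m : 'I_K.+1) out1 :
    fstep (pad_conf (PEmit b m) i b s d out1) =
    pad_conf (if m == 0 :> nat then if s == 0 then PSep else PPass b false
              else PEmit b (inord m.-1)) i b s d (rcons out1 pad).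
  rewrite pstep //= /pact /=.
  have -> : (if mark (if b == b then s else d) is None then PPass b false
             else PSep) = if s == 0 then PSep else PPass b false :> pst.
    by rewrite eqxx; case: s => [|s] //; rewrite mark_pos.
  congr FConfig; apply: funext => t.
    case: t => [||[w|[b'|[]]]] //=; try exact: update_id.
    by rewrite map_rcons -tape_of_rcons size_map.
  by case: t => [||[w|[b'|[]]]] //=; rewrite size_rcons.
case: n => n lt_n /=.
elim: n lt_n out => [|n IHn] lt_n out.
  by apply: reaches_step; rewrite step_emit /= cats1.
apply: reaches_stepr (step_emit _ _) _ => /=.
have -> : inord n = Ordinal (ltnW lt_n).
  by apply: val_inj; rewrite /= inordK // ltnW.
by rewrite -cat_rcons; apply: IHn.
Qed.

(** The flag [p] alternates, so the other counter advances at every second step. Starting from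
    [p = false] and [d = 0] it ends at [s./2]; general [p] and [d] are needed for the induction. *)
Lemma halving_pass i b p s d out :
  reaches s (pad_conf (PPass b p) i b s d out)
    (pad_conf (PPass b (p (+) odd s)) (i - s) b 0 (d + (s + p)./2) out).
Proof.
elim: s i p d => [|s IHs] i p d.
  by rewrite addbF subn0; case: p; rewrite /= addn0; exact: reaches_refl.
apply: (@reaches_stepr _ _ _ _
  (pad_conf (PPass b (~~ p)) i.-1 b s (d + p) out)).
  rewrite pstep //= eqxx mark_pos //=.
  congr FConfig; apply: funext => -[||[w|[b'|[]]]] //=; try exact: update_id.
  by case: (b' == b) => //; case: p; rewrite ?addn1 ?addn0.
have -> : p (+) odd s.+1 = ~~ p (+) odd s by rewrite /= addbN addNb.
have -> : i - s.+1 = i.-1 - s by lia.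
have -> : d + (s.+1 + p)./2 = d + p + (s + ~~ p)./2 by case: p => /=; lia.
exact: IHs.
Qed.

(** Strong induction on [v]: a block and a pass reduce the counter to [v./2] and exchange the roles
    of the counters. As [i <= v], the first pass already brings the input head to cell 0. *)
Lemma emit_pad v i b out : i <= v ->
  exists b', reaches (v.+1 * (v + K + 5))
    (pad_conf (PEmit b ord_max) i b v 0 out)
    (pad_conf PSep 0 b' 0 0 (out ++ nseq (K.+1 * rounds v) pad)).
Proof.
elim/ltn_ind: v i b out => v IHv i b out le_i.
have := emit_round i b v 0 ord_max out; case: (posnP v) => [v0|v_gt0] /= E.
  exists b; move: le_i E; rewrite v0 leqn0 => /eqP ->; rewrite muln1.
  by apply: reaches_leq; lia.
have lt_v2 : v./2 < v by lia.
have [b' E'] := IHv _ lt_v2 0 (~~ b) (out ++ nseq K.+1 pad) (leq0n _).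
exists b'; move: E'; rewrite -catA -nseqD => E'.
have E2 := halving_pass i b false v 0 (out ++ nseq K.+1 pad).
have E3 : reaches 1 (pad_conf (PPass b (false (+) odd v)) (i - v) b 0
      (0 + (v + false)./2) (out ++ nseq K.+1 pad))
    (pad_conf (PEmit (~~ b) ord_max) 0 (~~ b) v./2 0 (out ++ nseq K.+1 pad)).
  rewrite addn0 add0n pad_conf_swap; apply: reaches_step.
  have -> : i - v = 0 by lia.
  rewrite pstep //=; case: (b) => /=;
  by congr FConfig; apply: funext => -[||[w|[b1|[]]]] //=; exact: update_id.
move: E => /reaches_trans /(_ E2) /reaches_trans /(_ E3).
move=> /reaches_trans /(_ E'); rewrite (rounds_half v_gt0) mulnS.
apply: reaches_leq; nia.
Qed.

(** * Simulating [M] behind the pad and appending its output *)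

Hypothesis ordM : ordinary M.

(** The common position [h] of the tracker and of the head on the simulated output tape is kept
    apart from [c], as rewinding and copying change it while [c] is fixed. *)
Definition sim_conf (q : pst) (c : fconfig M) h (out : seq (A + aux M)) :
    fconfig padding_machine :=
  @FConfig _ padding_machine q
    (fun t => match t with
              | Input => ftape c Input
              | Output => tape_of out
              | Work (inl w) => ftape c (Work w)
              | Work (inr (inr false)) => ftape c Output
              | _ => mark end)
    (fun t => match t with
              | Input => fhead c Input
              | Output => size out
              | Work (inl w) => fhead c (Work w)
              | Work (inr (inr _)) => h
              | _ => 0 end).

(** A step of a halted [c] is simulated by no step at all, which [reaches] permits; so the machine
    is still in [PSim] at the end. *)
Lemma simulation n c out :
  reaches n (sim_conf (PSim (fstate c)) c (fhead c Output) out)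
    (let c' := iter n (@fstep _ M) c in
     sim_conf (PSim (fstate c')) c' (fhead c' Output) out).
Proof.
elim: n c => [|n IHn] c; first exact: reaches_refl.
rewrite iterSr; have [hc|hc] := boolP (halting (fstate c)).
  by rewrite {2}/fstep hc; apply: reaches_leq (IHn c).
apply: reaches_stepr (IHn _).
rewrite pstep //= (negPf hc) (fstep_shift (negPf hc) (@ordM _ _)) /=.
have -> : (fun t : tape (work M) =>
    match simulated t with
    | Input => ftape c Input
    | Output => tape_of out
    | Work (inl w) => ftape c (Work w)
    | Work (inr (inr false)) => ftape c Output
    | _ => mark end
    match simulated t with
    | Input => fhead c Input
    | Output => size out
    | Work (inl w) => fhead c (Work w)
    | Work (inr (inr _)) => fhead c Output
    | _ => 0 end) = (fun t => ftape c t (fhead c t)).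
  by apply: funext => -[].
congr FConfig; apply: funext => -[||[w|[b|[]]]] //=; exact: update_id.
Qed.

Lemma rewinding h c out :
  reaches h.+1 (sim_conf PRewind c h out) (sim_conf PCopy c 0 out).
Proof.
elim: h => [|h IHh].
  apply: reaches_step; rewrite pstep //=.
  by congr FConfig; apply: funext => -[||[w|[b|[]]]] //=; exact: update_id.
apply: reaches_stepr IHh; rewrite pstep //= mark_pos //=.
by congr FConfig; apply: funext => -[||[w|[b|[]]]] //=; exact: update_id.
Qed.

(** Induction on the part [v] not yet copied. The tape is prescribed only up to its first blank,
    since [M] may have left other symbols beyond it. *)
Lemma copying c u v out :
  (forall i, i <= size (u ++ v) -> ftape c Output i = tape_of (u ++ v) i) ->
  reaches (size v).+1 (sim_conf PCopy c (size u) out)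
    (sim_conf PHalt c (size (u ++ v)) (out ++ v)).
Proof.
elim: v u out => [|x v IHv] u out tc; have := tc (size u).
  rewrite cats0 leqnn tape_of_default // => /(_ isT) tN.
  apply: reaches_step; rewrite pstep //= tN cats0 /=.
  by congr FConfig; apply: funext => -[||[w|[b|[]]]] //=; exact: update_id.
rewrite size_cat leq_addr tape_of_size_cat => /(_ isT) tS.
rewrite -size_cat -cat_rcons -(cat_rcons x out).
apply: reaches_stepr (IHv _ _ _); last first.
  by rewrite cat_rcons.
rewrite pstep //= tS /= size_rcons.
congr FConfig; apply: funext => -[||[w|[b|[]]]] //=; try exact: update_id.
  exact: tape_of_rcons.
by rewrite size_rcons.
Qed.

(** The phases are composed in order. Of the summand [T.*2], one [T] pays for the simulation and one
    for rewinding, the output head being at most [T] cells from the start. *)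
Lemma padding_machine_outputs v T : outputs_within M D v T ->
  outputs_within padding_machine D
    (nseq (K.+1 * rounds (size D)) pad ++ sep :: v)
    ((size D).+1 * (size D + K + 6) + T.*2 + size v + 5).
Proof.
set n := size D => -[hT outT].
set out := nseq _ pad ++ _.
set c := iter T (@fstep _ M) (finit M D).
have eq_c : forget (run M D T) = c by apply: forget_run; left.
have hc : halting (fstate c) by rewrite -eq_c.
have tc i : i <= size v -> ftape c Output i = tape_of (map inl v) i.
  by rewrite -eq_c /= -outT => le_i; rewrite nth_contents // outT size_map.
have [b E2] := @emit_pad n n true [::] (leqnn n).
have E1 := scan_input (leqnn n); rewrite subnn in E1.
set out0 := rcons ([::] ++ nseq (K.+1 * rounds n) pad) sep.
have E3 : reaches 1 (pad_conf PSep 0 b 0 0 ([::] ++ nseq (K.+1 * rounds n) pad))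
    (sim_conf (PSim (fstate (finit M D))) (finit M D)
      (fhead (finit M D) Output) (map inl out0)).
  apply: reaches_step; rewrite pstep //=.
  congr FConfig; apply: funext => -[||[w|[b'|[]]]] //=; try exact: update_id.
  - by rewrite map_rcons -tape_of_rcons size_map.
  - by rewrite size_map size_rcons.
  - by case: ifP.
have E4 := simulation T (finit M D) (map inl out0); rewrite -/c /= in E4.
have E5 : reaches 1
    (sim_conf (PSim (fstate c)) c (fhead c Output) (map inl out0))
    (sim_conf PRewind c (fhead c Output) (map inl out0)).
  apply: reaches_step; rewrite pstep //= hc.
  by congr FConfig; apply: funext => -[||[w|[b'|[]]]] //=; exact: update_id.
have E6 := rewinding (fhead c Output) c (map inl out0).
have E7 := @copying c [::] (map inl v) (map inl out0).
rewrite /= size_map in E7; have {}E7 := E7 tc.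
have := reaches_trans scan_start (reaches_trans E1 (reaches_trans E2
  (reaches_trans E3 (reaches_trans E4 (reaches_trans E5
  (reaches_trans E6 E7)))))).
have le_h : fhead c Output <= T by exact: fhead_iter.
set N := (X in outputs_within _ _ _ X) => E.
have {}E : forget (run padding_machine D N) =
    sim_conf PHalt c (size v) (map inl out0 ++ map inl v).
  rewrite forget_run; last by left; exact: padding_machine_ordinary.
  by apply: reaches_halting (reaches_leq _ E) _; rewrite // /N; nia.
split.
  have /= := congr1 (@fstate _ padding_machine) E.
  by rewrite /halts_within => ->.
apply: contents_tape_of.
have /= -> := congr1 (fun c => @ftape _ padding_machine c Output) E.
by rewrite /out0 -map_cat cat_rcons.
Qed.

End PaddingMachine.

(** * Deciding padded queries *)

Inductive dstate (Q : Type) :=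
  DStart | DPad | DCopy | DQuery | DJump | DReject | DSim of Q.
Arguments DStart {Q}.
Arguments DPad {Q}.
Arguments DCopy {Q}.
Arguments DQuery {Q}.
Arguments DJump {Q}.
Arguments DReject {Q}.

Definition dstate_code Q (q : dstate Q) : Q + 'I_6 :=
  match q with
  | DSim q => inl q
  | DStart => inr (inord 0) | DPad => inr (inord 1) | DCopy => inr (inord 2)
  | DQuery => inr (inord 3) | DJump => inr (inord 4) | DReject => inr (inord 5)
  end.

Definition dstate_decode Q (x : Q + 'I_6) : dstate Q :=
  match x with
  | inl q => DSim q
  | inr i => nth DReject [:: DStart; DPad; DCopy; DQuery; DJump] i
  end.

Lemma dstate_codeK Q : cancel (@dstate_code Q) (@dstate_decode Q).
Proof. by case=> //=; rewrite inordK. Qed.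

HB.instance Definition _ (Q : finType) :=
  Finite.copy (dstate Q) (can_type (@dstate_codeK Q)).

Section QueryMachine.
Variables (Sigma : finType) (M : ratm (option Sigma)) (pad sep : Sigma).

(* [inr true] is the input tape of [M], [inr false] is a counter whose value is
   the head position. *)
Definition dwork : finType := (work M + bool)%type.

Notation dtape := (tape dwork).
Notation dsym := (option (option Sigma + aux M)).
Notation dst := (dstate (state M)).

Definition dsimulated (t : tape (work M)) : dtape :=
  match t with
  | Input => Work (inr true)
  | Output => Output
  | Work w => Work (inl w)
  end.

Definition dact (q : dst) (wr : dtape -> dsym) (mv : dtape -> move) :=
  Action q wr mv (fun=> None) (fun=> Stay).

(** [DQuery] tests for the end of the input before it looks at the counter, so a query exactly as
    long as the pad is still accepted for simulation. *)
Definition ddelta (q : dst) (r : dtape -> dsym) : action dst dtape dsym :=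
  match q with
  | DStart =>
    dact DPad (fun t => if t is Work (inr false) then Some (inl None) else r t)
      (fun=> Stay)
  | DPad =>
    if r Input == Some (inl (Some pad)) then
      dact DPad r (fun t => match t with
                            | Input | Work (inr false) => MoveRight
                            | _ => Stay end)
    else dact DCopy r (fun t => if t is Input then MoveRight else Stay)
  | DCopy =>
    dact (if r Input is Some (inl (Some _)) then DCopy else DQuery)
      (fun t => if t is Work (inr true) then r Input else r t)
      (fun t => match t with
                | Input | Work (inr true) => MoveRight
                | _ => Stay end)
  | DQuery =>
    if r Input is None then dact DJump r (fun=> Stay)
    else if r (Work (inr false)) is Some _ then dact DReject r (fun=> Stay)
    else dact DQuery
      (fun t => if t is Work (inr true) then r Input else r t)
      (fun t => match t with
                | Input | Work (inr true) => MoveRight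
                | Work (inr false) => MoveLeft
                | _ => Stay end)
  | DJump => dact (DSim (start M)) r (fun=> Stay)
  | DReject => dact DReject r (fun=> Stay)
  | DSim q =>
    let a := delta q (fun t => r (dsimulated t)) in
    dact (DSim (next a))
      (fun t => match t with
                | Work (inl w) => write a (Work w)
                | Output => write a Output
                | _ => r t end)
      (fun t => match t with
                | Work (inl w) => shead a (Work w)
                | Output => shead a Output
                | Work (inr true) => shead a Input
                | _ => Stay end)
  end.

(* Entering [DJump] moves all heads to cell 0, as the index tapes are blank. *)
Definition query_machine : ratm (option Sigma) :=
  @RATM (option Sigma) dwork (aux M) dst DStart DJump
    (fun q => match q with
              | DSim q => halting q | DReject => true | _ => false end)
    (fun q => if q is DSim q then accepting q else false) ddelta.

Lemma query_machine_index_free : index_free query_machine.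
Proof.
move=> q r t; case: q => [||||||q] //=; first by case: ifP.
by case: (r Input) => //; case: (r _).
Qed.

Notation mark := (tape_of [:: (inl None : option Sigma + aux M)]).

Variable w : seq (option Sigma).

(** Here [p] is the value of the counter and [z] the part of the input of [M] copied so far. *)
Definition read_conf (q : dst) i p z : fconfig query_machine :=
  @FConfig _ query_machine q
    (fun t => match t with
              | Input => tape_of (map inl w)
              | Work (inr true) => tape_of (map inl z)
              | Work (inr false) => mark
              | _ => fun=> None end)
    (fun t => match t with
              | Input => i
              | Work (inr true) => size z
              | Work (inr false) => p
              | _ => 0 end).

Lemma read_start : reaches 1 (finit query_machine w) (read_conf DPad 0 0 [::]).
Proof.
apply: reaches_step; rewrite fstep_shift //.
congr FConfig; apply: funext => -[||[x|[]]] //=; rewrite ?tape_of_nil;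
  try by rewrite [LHS]update_id.
by apply: funext => -[|[]].
Qed.

Lemma read_pad k v : w = nseq k (Some pad) ++ v ->
  reaches k (read_conf DPad 0 0 [::]) (read_conf DPad k k [::]).
Proof.
move=> eq_w; suff pads j : j <= k ->
    reaches j (read_conf DPad 0 0 [::]) (read_conf DPad j j [::]).
  exact: pads.
elim: j => [|j IHj] lt_j; first exact: reaches_refl.
rewrite -addn1; apply: reaches_trans (IHj (ltnW lt_j)) _.
have eq_j : tape_of (map inl w) j = Some (inl (Some pad)) :> dsym.
  rewrite eq_w -(subnKC lt_j) addSnnS nseqD -catA.
  by rewrite -[X in tape_of _ X](size_nseq j (Some pad)) tape_of_map_cat.
apply: reaches_step; rewrite addn1 fstep_shift //= eq_j eqxx //=.
by congr FConfig; apply: funext => -[||[x|[]]] //=; exact: update_id.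
Qed.

Lemma read_sep w1 w2 p z : pad != sep -> w = w1 ++ Some sep :: w2 ->
  reaches 1 (read_conf DPad (size w1) p z) (read_conf DCopy (size w1).+1 p z).
Proof.
move=> neq_ps eq_w; apply: reaches_step.
have eq_r : tape_of (map inl w) (size w1) = Some (inl (Some sep)) :> dsym.
  by rewrite eq_w tape_of_map_cat.
have neq : (Some (inl (Some sep)) == Some (inl (Some pad)) :> dsym) = false.
  by apply/eqP => -[eq_sp]; rewrite eq_sp eqxx in neq_ps.
rewrite fstep_shift //= eq_r neq //=.
by congr FConfig; apply: funext => -[||[x|[]]] //=; exact: update_id.
Qed.

Lemma read_dataset u w1 w2 p z : w = w1 ++ map Some u ++ None :: w2 ->
  reaches (size u).+1 (read_conf DCopy (size w1) p z)
    (read_conf DQuery (size w1 + (size u).+1) p (z ++ rcons (map Some u) None)).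
Proof.
elim: u w1 z => [|a u IHu] w1 z eq_w.
  apply: reaches_step; rewrite addn1 cats1.
  have eq_r : tape_of (map inl w) (size w1) = Some (inl None) :> dsym.
    by rewrite eq_w tape_of_map_cat.
  rewrite fstep_shift //= eq_r //=.
  congr FConfig; apply: funext => -[||[x|[]]] //=; rewrite ?size_rcons //;
    try exact: update_id.
  by rewrite map_rcons -tape_of_rcons size_map.
apply: (@reaches_stepr _ _ _ _
  (read_conf DCopy (size w1).+1 p (rcons z (Some a)))).
  have eq_r : tape_of (map inl w) (size w1) = Some (inl (Some a)) :> dsym.
    by rewrite eq_w tape_of_map_cat.
  rewrite fstep_shift //= eq_r //=.
  congr FConfig; apply: funext => -[||[x|[]]] //=; rewrite ?size_rcons //;
    try exact: update_id.
  by rewrite map_rcons -tape_of_rcons size_map.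
have := IHu (rcons w1 (Some a)) (rcons z (Some a)).
by rewrite !cat_rcons size_rcons addSnnS; apply.
Qed.

Lemma read_query v w1 w2 p z : w = w1 ++ v ++ w2 -> size v <= p ->
  reaches (size v) (read_conf DQuery (size w1) p z)
    (read_conf DQuery (size w1 + size v) (p - size v) (z ++ v)).
Proof.
elim: v w1 p z => [|a v IHv] w1 p z eq_w lt_p.
  by rewrite addn0 subn0 cats0; exact: reaches_refl.
case: p lt_p => // p lt_p.
apply: (@reaches_stepr _ _ _ _ (read_conf DQuery (size w1).+1 p (rcons z a))).
  have eq_r : tape_of (map inl w) (size w1) = Some (inl a) :> dsym.
    by rewrite eq_w tape_of_map_cat.
  rewrite fstep_shift //= eq_r tape_of_default //=.
  congr FConfig; apply: funext => -[||[x|[]]] //=; rewrite ?size_rcons //;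
    try exact: update_id.
  by rewrite map_rcons -tape_of_rcons size_map.
have := IHv (rcons w1 a) p (rcons z a).
by rewrite !cat_rcons size_rcons addSnnS; apply.
Qed.

Lemma read_reject i z : i < size w ->
  reaches 1 (read_conf DQuery i 0 z) (read_conf DReject i 0 z).
Proof.
move=> lt_i; apply: reaches_step.
have eq_r : exists x, tape_of (map inl w) i = Some x :> dsym.
  by exists (nth (inl None) (map inl w) i); rewrite -tape_of_nth ?size_map.
have [x {}eq_r] := eq_r; rewrite fstep_shift //= eq_r //=.
by congr FConfig; apply: funext => -[||[y|[]]] //=; exact: update_id.
Qed.

Definition dsim_conf (q : dst) (c : fconfig M) : fconfig query_machine :=
  @FConfig _ query_machine q
    (fun t => match t with
              | Input => tape_of (map inl w)
              | Output => ftape c Output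
              | Work (inl x) => ftape c (Work x)
              | Work (inr true) => ftape c Input
              | Work (inr false) => mark end)
    (fun t => match t with
              | Output => fhead c Output
              | Work (inl x) => fhead c (Work x)
              | Work (inr true) => fhead c Input
              | _ => 0 end).

Lemma jump p z :
  reaches 2 (read_conf DQuery (size w) p z)
    (dsim_conf (DSim (start M)) (finit M z)).
Proof.
apply: (@reaches_stepr _ _ _ _ (dsim_conf DJump (finit M z))).
  (* This step enters [qa], so [fstep] is unfolded instead of using [fstep_shift]. *)
  rewrite /fstep /= tape_of_default ?size_map //= eqxx.
  by congr FConfig; apply: funext => -[||[x|[]]] //=; exact: update_id.
apply: reaches_step; rewrite fstep_shift //=.
by congr FConfig; apply: funext => -[||[x|[]]] //=; exact: update_id.
Qed.

Hypothesis ordM : ordinary M.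

Lemma dsimulation n c :
  reaches n (dsim_conf (DSim (fstate c)) c)
    (let c' := iter n (@fstep _ M) c in dsim_conf (DSim (fstate c')) c').
Proof.
elim: n c => [|n IHn] c; first exact: reaches_refl.
rewrite iterSr; have [hc|hc] := boolP (halting (fstate c)).
  by rewrite {2}/fstep hc; apply: reaches_leq (IHn c).
apply: reaches_stepr (IHn _).
rewrite (fstep_shift (negPf hc) (@ordM _ _)) fstep_shift /= ?(negPf hc) //.
have -> : (fun t : tape (work M) =>
    match dsimulated t with
    | Input => tape_of (map inl w)
    | Output => ftape c Output
    | Work (inl x) => ftape c (Work x)
    | Work (inr true) => ftape c Input
    | Work (inr false) => mark end
    match dsimulated t with
    | Output => fhead c Output
    | Work (inl x) => fhead c (Work x)
    | Work (inr true) => fhead c Input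
    | _ => 0 end) = (fun t => ftape c t (fhead c t)).
  by apply: funext => -[].
by congr FConfig; apply: funext => -[||[x|[]]] //=; exact: update_id.
Qed.

End QueryMachine.

(** * Correctness and running time on padded words *)

Section QueryMachineCorrect.
Variables (Sigma : finType) (M : ratm (option Sigma)) (pad sep : Sigma).
Hypotheses (neq_pad_sep : pad != sep) (ordM : ordinary M).

(** The bound is independent of [size v]: at most [k] symbols of the query are copied, and [M] is
    started only if the whole query fits. Rejecting longer queries is correct by the second
    hypothesis. *)
Lemma query_machine_decides k u v (P : Prop) T :
  (size v <= k -> decides_within M (encode (u, v)) P T) -> (P -> size v <= k) ->
  decides_within (query_machine M pad) (encode (nseq k pad ++ sep :: u, v)) P
    (k.*2 + size u + T + 6).
Proof.
move=> decM short; set w := encode (nseq _ _ ++ _, _).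
have eq_w : w =
    nseq k (Some pad) ++ Some sep :: map Some u ++ None :: map Some v.
  by rewrite /w /encode /= map_cat map_nseq -catA.
have eq_w1 : w =
    rcons (nseq k (Some pad)) (Some sep) ++ map Some u ++ None :: map Some v.
  by rewrite cat_rcons.
set w2 := rcons (rcons (nseq k (Some pad)) (Some sep) ++ map Some u) None.
have eq_w2 : w = w2 ++ map Some v by rewrite /w2 cat_rcons -catA -eq_w1.
have E1 := read_pad M eq_w.
have E2 := read_sep M (size (nseq k (Some pad))) [::] neq_pad_sep eq_w.
have E3 := read_dataset M pad k [::] eq_w1.
have size_w2 : size w2 = k + (size u).+2.
  by rewrite /w2 size_rcons size_cat size_rcons size_nseq size_map; lia.
rewrite !size_nseq in E2.
rewrite size_rcons size_nseq addSnnS -size_w2 cat0s in E3.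
have {E1 E2 E3} := reaches_trans (read_start M pad w)
  (reaches_trans E1 (reaches_trans E2 E3)).
set z := rcons _ _ => E.
set N := (X in decides_within _ _ _ X).
have run_forget n : forget (run (query_machine M pad) w n)
    = iter n (@fstep _ (query_machine M pad)) (finit _ w).
  by apply: forget_run; right; exact: query_machine_index_free.
have run_state n c : reaches n (finit (query_machine M pad) w) c ->
    n <= N -> halting (fstate c) ->
    cstate (run (query_machine M pad) w N) = fstate c.
  move=> Ec le_n hc; rewrite -[LHS]/(fstate (forget _)) run_forget.
  by rewrite (reaches_halting (reaches_leq le_n Ec) hc).
have [le_v|lt_k] := leqP (size v) k.
  have [hT accT] := decM le_v.
  have E4 := @read_query _ M pad w (map Some v) w2 [::] k z.
  rewrite cats0 size_map in E4; have {}E4 := E4 eq_w2 le_v.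
  have size_w : size w2 + size v = size w by rewrite eq_w2 size_cat size_map.
  rewrite size_w in E4.
  have eq_z : z ++ map Some v = encode (u, v) by rewrite cat_rcons.
  have E5 := jump M pad w (k - size v) (encode (u, v)).
  have E6 := dsimulation pad w ordM T (finit M (encode (u, v))).
  rewrite eq_z in E4.
  have eq_c : forget (run M (encode (u, v)) T)
     = iter T (@fstep _ M) (finit M (encode (u, v))) by apply: forget_run; left.
  rewrite -eq_c /= in E6.
  have {}E := reaches_trans E (reaches_trans E4 (reaches_trans E5 E6)).
  have eq_s := run_state _ _ E _ hT.
  rewrite /decides_within /halts_within eq_s //= /N; lia.
(* After [k] symbols of a longer query the counter is 0 while input remains. *)
have E4 := @read_query _ M pad w (map Some (take k v)) w2
  (map Some (drop k v)) k z.
rewrite -map_cat cat_take_drop size_map size_takel ?(ltnW lt_k) // subnn in E4.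
have {}E4 := E4 eq_w2 (leqnn k).
have lt_w : size w2 + k < size w by rewrite eq_w2 size_cat size_map; lia.
have {}E := reaches_trans E (reaches_trans E4 (read_reject M pad _ lt_w)).
have eq_s := run_state _ _ E _ isT.
rewrite /decides_within /halts_within eq_s /N /=; last by lia.
by split=> //; split=> // /short; rewrite leqNgt lt_k.
Qed.

End QueryMachineCorrect.

(** * The two classes *)

Lemma run_halting (A : finType) (M : ratm A) w m n :
  halts_within M w m -> m <= n -> run M w n = run M w m.
Proof.
move=> hm le_mn; rewrite /run -(subnK le_mn) iterD -/(run M w m).
by elim: (n - m) => //= j ->; rewrite /step hm.
Qed.

Lemma outputs_within_leq (A : finType) (M : ratm A) w v m n :
  m <= n -> outputs_within M w v m -> outputs_within M w v n.
Proof.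
move=> le_mn [hm out_m].
by rewrite /outputs_within /halts_within (run_halting hm).
Qed.

Lemma decides_within_leq (A : finType) (M : ratm A) w P m n :
  m <= n -> decides_within M w P m -> decides_within M w P n.
Proof.
move=> le_mn [hm dec_m].
by rewrite /decides_within /halts_within (run_halting hm).
Qed.

Lemma encode_inj (Sigma : finType) : injective (@encode Sigma).
Proof.
move=> [x y] [x' y']; rewrite /encode /=.
elim: x x' => [|a x IHx] [|b x'] //= [].
  by move/(inj_map Some_inj) => ->.
by move=> -> /IHx[-> ->].
Qed.

(** Padding costs quadratic time and [M] takes time of order [n ^ d]; the exponent [d.+2] dominates
    both. *)
Lemma polytime_pad (Sigma : finType) (Pi : seq Sigma -> seq Sigma) K a pad sep :
  polytime_computable Pi -> (forall D, size (Pi D) <= a * (size D).+1) ->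
  polytime_computable
    (fun D => nseq (K.+1 * rounds (size D)) pad ++ sep :: Pi D).
Proof.
move=> [M [c [d [ordM outM]]]] le_Pi.
exists (padding_machine M K pad sep), (K + 4 * c + a + 20), d.+2.
split=> [|D]; first exact: padding_machine_ordinary.
have := padding_machine_outputs K pad sep ordM (outM D).
apply: outputs_within_leq; move: (le_Pi D); set n := size D => le_n.
have le2 : n * n <= n ^ d.+2.
  case: (n) => [|n'] //; rewrite !expnS mulnA leq_pmulr // expn_gt0 //.
have le1 : n <= n * n by case: (n) => // n'; rewrite leq_pmulr.
(* The summand 1 covers [n = d = 0], where the left side is 1 and the power on the right is 0. *)
have le0 : n ^ d <= n ^ d.+2 + 1.
  case: (n) => [|n']; first by case: (d) => [|d']; rewrite ?expnS ?mul0n.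
  by rewrite (leq_trans _ (leq_addr _ _)) // leq_pexp2l // ltnW.
have := leq_mul (leqnn c) le0.
move: (n ^ d) (n ^ d.+2) le2 => x y le2; nia.
Qed.

(** * The inclusion *)

Lemma padded_inj (Sigma : eqType) (pad sep : Sigma) k k' u u' : pad != sep ->
  nseq k pad ++ sep :: u = nseq k' pad ++ sep :: u' -> u = u'.
Proof.
move=> neq_ps; elim: k k' => [|k IHk] [|k'] //= [] //; last exact: IHk.
  by move=> eq_ps; rewrite eq_ps eqxx in neq_ps.
by move=> eq_ps; rewrite eq_ps eqxx in neq_ps.
Qed.

Lemma PiT0Q_sub_PTR0Q (Sigma : finType) :
  1 < #|Sigma| -> PiT0Q Sigma `<=` PTR0Q Sigma.
Proof.
move=> /card_gt1P[pad [sep [_ _ neq_ps]]] S [[fQ [/big_O_log2[K leK] short]]].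
move=> [Pi [S' [polyPi [fP [/big_O_log2[a lea] lePi]] PS' SS']]].
have [M0 [c0 [d0 [ord0 dec0]]]] := PS'.
pose k (D : seq Sigma) := K.+1 * rounds (size D).
pose Pi' D := nseq (k D) pad ++ sep :: Pi D.
have le_size D : size (Pi D) <= a * (log2 (size D)).+1.
  exact: leq_trans (lea _).
have le_k D : k D <= K.+1 * 2 * (log2 (size D)).+1.
  by rewrite -mulnA leq_mul2l rounds_le orbT.
have short_k D Q : S (D, Q) -> size Q <= k D.
  move=> /short le_Q; apply: leq_trans le_Q (leq_trans (leK _) _).
  by rewrite leq_mul // log2_lt_rounds.
(* The new language consists of the images of the pairs in [S]. This is consistent because [Pi' D]
   determines [Pi D], and hence the truth of each query. *)
have S_Pi' D Q : S (D, Q) <-> exists2 D', Pi' D = Pi' D' & S (D', Q).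
  split; first by exists D.
  by case=> D' /(padded_inj neq_ps) eqD; rewrite !SS' eqD.
exists Pi', [set p | exists2 D, p.1 = Pi' D & S (D, p.2)]; split => //.
- apply: (@polytime_pad _ _ _ a) => // D.
  by apply: leq_trans (le_size D) _; rewrite leq_mul2l ltnS log2_le orbT.
(* The summands pay for the pad, for [Pi D], and with 2 for the separator and the strictness of the
   inequality. *)
- pose C := K.+1 * 2 + a + 2.
  have [N leN] := polylog_little_o C 1 1; exists N => D /leN.
  rewrite mul1n expn1; apply: leq_trans.
  rewrite size_cat size_nseq /= /C; have := le_size D; have := le_k D; nia.
(* Up to the logarithmic factor, [B] bounds the length of the encoding of [Pi D] and a query that
   fits in the pad. *)
pose B := K.+1 * 2 + a + 1.
exists (query_machine M0 pad).
(* The exponent [d0.+1] also covers the linear cost of reading when [d0 = 0]. *)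
exists (fun n => (3 * B + 6 + c0 * (2 * B) ^ d0 + c0) * (log2 n).+1 ^ d0.+1).
split=> [|D Q]; first exact: polylog_little_o.
set l := (log2 (size D)).+1; set T := c0 * (2 * B * l) ^ d0 + c0.
have l_gt0 : 0 < l ^ d0 by rewrite expn_gt0.
apply: (@decides_within_leq _ _ _ _ (k D * 2 + size (Pi D) + T + 6)).
  rewrite /T expnMn expnS; have := le_size D; have := le_k D; rewrite -/l /B.
  move: (_ ^ d0) (l ^ d0) l_gt0 => x y y_gt0; nia.
rewrite -[X in decides_within _ _ X]/(exists2 D', Pi' D = Pi' D' & S (D', Q)).
rewrite -(propext (S_Pi' D Q)) muln2.
apply: query_machine_decides => // [le_Q|]; last exact: short_k.
(* [M0] decides the set of encodings; injectivity of [encode] turns this into membership in [S']. *)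
have -> : S (D, Q) = [set encode x | x in S'] (encode (Pi D, Q)).
  apply: propext; rewrite SS'; split=> [|[x S'x /encode_inj <-]] //.
  by exists (Pi D, Q).
apply: decides_within_leq (dec0 _); rewrite /T leq_add2r leq_mul2l.
apply/orP; right; case: (d0) => [|d] //; rewrite leq_exp2r //.
rewrite size_cat /= !size_map; have := le_size D; have := le_k D.
by rewrite -/l /B; nia.
Qed.

(** * Strictness *)

Lemma polytime_nil (A : finType) : polytime_computable (fun _ : seq A => [::]).
Proof.
pose M := @RATM A unit unit bool true false id xpred0
  (fun _ r => Action true r (fun=> Stay) (fun=> None) (fun=> Stay)).
by exists M, 0, 0; split.
Qed.

(** The start state of the decider is halting and accepting, so the time bound is 0. Erasing
    shortens every dataset of length at least 1. *)
Lemma setT_PTR0Q (Sigma : finType) : PTR0Q Sigma setT.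
Proof.
exists (fun=> [::]), setT; split=> //; first exact: polytime_nil.
  by exists 1.
exists (@RATM (option Sigma) unit unit bool true false id xpredT
  (fun _ r => Action true r (fun=> Stay) (fun=> None) (fun=> Stay))).
by exists (fun=> 0); split=> [m|D Q]; first by exists 0 => n; rewrite muln0.
Qed.

(** The empty dataset admits queries of every length, in particular one of length [(f 0).+1]. *)
Lemma setT_not_short (Sigma : finType) (a : Sigma) :
  ~ short_queries (setT : query_class Sigma).
Proof.
move=> [f [_ leF]]; have := leF [::] (nseq (f 0).+1 a) I.
by rewrite size_nseq ltnn.
Qed.

Theorem theorem9 (Sigma : finType) (Sigma_gt1 : (1 < #|Sigma|)%N) :
  PiT0Q Sigma `<` PTR0Q Sigma.
Proof.
split; first exact: PiT0Q_sub_PTR0Q.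
have /card_gt0P[a _] := ltnW Sigma_gt1.
by move=> /(_ _ (setT_PTR0Q Sigma)) [/(setT_not_short a)].
Qed.
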